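(* Let $k\ge2$ be an integer and let $P'=P'_{8\cdot3^k}=\langle x,y,z\mid x^2=(xy)^2=y^2,\ zxz^{-1}=y,\ zyz^{-1}=xy,\ z^{3^k}=1\rangle$, with natural representation $\rho_{\mathrm{Nat}}=\varrho_1$. The McKay quiver $Q_{\rho_{\mathrm{Nat}}}(P')$ has as vertices the irreducible representations $\alpha_i$ and $\varrho_i$, with $i\in\mathbb{Z}/3^k$, and $\varsigma_s$, with $s\in\mathbb{Z}/3^{k-1}$, and its arrows are exactly the following (each with multiplicity one): - from $\alpha_i$ one arrow, to $\varrho_{i+1}$; - from $\varrho_i$ two arrows, to $\alpha_{i+1}$ and to $\varsigma_{i+1}$; - from $\varsigma_s$ three arrows, to $\varrho_{s+1}$, $\varrho_{3^{k-1}+s+1}$ and $\varrho_{2\cdot3^{k-1}+s+1}$, where indices of $\alpha$ and $\varrho$ are taken modulo $3^k$ and indices of $\varsigma$ are taken modulo $3^{k-1}$.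
   Context: For a finite group $G$ with complex irreducible representations $\rho_0,\dots,\rho_n$ (up to isomorphism) and a complex representation $\rho$ of $G$, write $\rho\otimes\rho_i\cong\bigoplus_j a_{ij}\rho_j$. The McKay quiver $Q_\rho(G)$ has one vertex for each $\rho_i$ and $a_{ij}$ arrows from the vertex $\rho_i$ to the vertex $\rho_j$. Put $\zeta_n=e^{2\pi i/n}$. The group $P'_{8\cdot3^k}$ has order $8\cdot3^k$. Its irreducible representations are: - one-dimensional $\alpha_j$, $0\le j\le 3^k-1$: $\alpha_j(z)=\zeta_{3^k}^j$, $\alpha_j(x)=\alpha_j(y)=1$; - two-dimensional $\varrho_j$, $0\le j\le3^k-1$: $$\varrho_j(x)=\begin{pmatrix}0&\zeta_3^2\\-\zeta_3&0\end{pmatrix},\quad \varrho_j(y)=\begin{pmatrix}\zeta_3^2&1\\\zeta_3^2&-\zeta_3^2\end{pmatrix},\quad \varrho_j(z)=\zeta_{3^k}^j\begin{pmatrix}0&\zeta_3\\-\zeta_3^2&-1\end{pmatrix};$$ - three-dimensional $\varsigma_s$, $0\le s\le3^{k-1}-1$: $$\varsigma_s(x)=\begin{pmatrix}-1&-1&-1\\0&0&1\\0&1&0\end{pmatrix},\quad \varsigma_s(y)=\begin{pmatrix}0&0&1\\-1&-1&-1\\1&0&0\end{pmatrix},\quad \varsigma_s(z)=\zeta_{3^k}^s\begin{pmatrix}-1&-1&-1\\0&1&0\\1&0&0\end{pmatrix}.$$ The isomorphism class of $\varsigma_s$ depends only on $s$ modulo $3^{k-1}$. The natural representation is $\varrho_1$.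 *)

(* Defs.v *)
From HB Require Import structures.
From mathcomp Require Import all_boot all_order all_algebra.
From mathcomp Require Import all_fingroup all_solvable all_field all_character.
From mathcomp Require Import complex.
From mathcomp Require Import reals trigo.

Set Implicit Arguments.
Unset Strict Implicit.
Unset Printing Implicit Defensive.

Import Order.TTheory GRing.Theory Num.Theory.
Local Open Scope ring_scope.

Section McKayQuiver.

Variables (F : fieldType) (gT : finGroupType) (G : {group gT}).
Variables (I : finType) (V : I -> representation F G).

(* V lists the irreducible representations of G up to isomorphism, each       *)
(* class exactly once.                                                        *)
Definition irr_system : Prop :=
  [/\ forall i, mx_irreducible (V i),
      forall i j, mx_rsim (V i) (V j) -> i = j
    & forall n (rG : mx_representation F G n),
        mx_irreducible rG -> exists i, mx_rsim rG (V i)].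

(* A quiver on the vertex set I is encoded by its numbers of arrows a i j     *)
(* from i to j.                                                               *)
Definition mckay_quiver n (rho : mx_representation F G n)
    (a : I -> I -> nat) : Prop :=
  forall i, mx_rsim (prod_repr rho (V i))
                    (\big[dadd_grepr/grepr0]_j muln_grepr (V j) (a i j)).

End McKayQuiver.

Definition zeta (R : realType) (n : nat) : R[i] :=
  Complex (cos (2 * pi / n%:R)) (sin (2 * pi / n%:R)).

Definition mx_of_rows (F : nzRingType) n (rows : seq (seq F)) : 'M[F]_n :=
  \matrix_(i, j) nth 0 (nth [::] rows i) j.

(* P is the group presented by generators x, y, z and the relations below,    *)
(* with the generators fixed in P: since the presented group is finite, the   *)
(* epimorphism onto P given by x, y, z is bijective as soon as P is           *)
(* abstractly isomorphic to it.                                               *)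
Definition is_P' (k : nat) (gT : finGroupType) (P : {group gT})
    (x y z : gT) : Prop :=
  [/\ <<[set x; y; z]>>%g = P :> {set gT},
      [/\ (x ^+ 2 = (x * y) ^+ 2)%g, ((x * y) ^+ 2 = y ^+ 2)%g,
          (z * x * z^-1 = y)%g, (z * y * z^-1 = x * y)%g
        & (z ^+ (3 ^ k) = 1)%g]
    & (P \isog Grp (X : Y : Z : X ^+ 2 = (X * Y) ^+ 2, (X * Y) ^+ 2 = Y ^+ 2,
                                Z * X * Z^-1 = Y, Z * Y * Z^-1 = X * Y,
                                Z ^+ (3 ^ k)%N))%g].

Section Matrices.

Variables (R : realType) (k : nat).
Let w : R[i] := zeta R 3.

Definition alphaz (j : nat) : 'M[R[i]]_1 := (zeta R (3 ^ k) ^+ j)%:M.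

Definition varrhox : 'M[R[i]]_2 :=
  mx_of_rows 2 [:: [:: 0; w ^+ 2]; [:: - w; 0]].
Definition varrhoy : 'M[R[i]]_2 :=
  mx_of_rows 2 [:: [:: w ^+ 2; 1]; [:: w ^+ 2; - w ^+ 2]].
Definition varrhoz (j : nat) : 'M[R[i]]_2 :=
  zeta R (3 ^ k) ^+ j *: mx_of_rows 2 [:: [:: 0; w]; [:: - w ^+ 2; -1]].

Definition varsigmax : 'M[R[i]]_3 :=
  mx_of_rows 3 [:: [:: -1; -1; -1]; [:: 0; 0; 1]; [:: 0; 1; 0]].
Definition varsigmay : 'M[R[i]]_3 :=
  mx_of_rows 3 [:: [:: 0; 0; 1]; [:: -1; -1; -1]; [:: 1; 0; 0]].
Definition varsigmaz (s : nat) : 'M[R[i]]_3 :=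
  zeta R (3 ^ k) ^+ s *:
  mx_of_rows 3 [:: [:: -1; -1; -1]; [:: 0; 1; 0]; [:: 1; 0; 0]].

End Matrices.

(* 'Z_n is the ring of integers modulo n only for n >= 2; both moduli below   *)
(* satisfy this when k >= 2.                                                  *)
Notation vertex k := ('Z_(3 ^ k) + 'Z_(3 ^ k) + 'Z_(3 ^ k.-1))%type.

Definition valpha k (i : 'Z_(3 ^ k)) : vertex k := inl (inl i).
Definition vvarrho k (i : 'Z_(3 ^ k)) : vertex k := inl (inr i).
Definition vvarsigma k (s : 'Z_(3 ^ k.-1)) : vertex k := inr s.

Definition vertex_repr (F : fieldType) (gT : finGroupType) (P : {group gT}) k
    (alpha : 'Z_(3 ^ k) -> mx_representation F P 1)
    (varrho : 'Z_(3 ^ k) -> mx_representation F P 2)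
    (varsigma : 'Z_(3 ^ k.-1) -> mx_representation F P 3)
    (v : vertex k) : representation F P :=
  match v with
  | inl (inl i) => Representation (alpha i)
  | inl (inr i) => Representation (varrho i)
  | inr s => Representation (varsigma s)
  end.

(* The targets of the arrows out of v. Elements of 'Z_n coerce to their       *)
(* representatives 0 <= i < n, and m%:R : 'Z_n is the class of m.             *)
Definition targets k (v : vertex k) : seq (vertex k) :=
  match v with
  | inl (inl i) => [:: vvarrho (i + 1)]
  | inl (inr i) => [:: valpha (i + 1); vvarsigma (i + 1)%N%:R]
  | inr s => [:: vvarrho (s + 1)%N%:R;
                 vvarrho (3 ^ k.-1 + s + 1)%N%:R;
                 vvarrho (2 * 3 ^ k.-1 + s + 1)%N%:R]
  end.

(* Main.v *)
(* Von Dyck's theorem for P' cannot be applied to the infinite group GL_n(C), so the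
   generators are made to act by right multiplication on the finite set of matrices
   X^a Y^b Z^c with a < 4, b < 2, c < 3^k.  The same normal form gives
   #|P| <= 8 * 3^k = 3^k * 1^2 + 3^k * 2^2 + 3^(k-1) * 3^2, hence the irreducible
   representations alpha_j, varrho_j, varsigma_s, which traces tell apart, are all of
   them.  In characteristic zero traces determine multiplicities, so the quiver
   follows from two identities on Q8 and its cosets, with t2 and t3 the traces
   of varrho_0 and varsigma_0: t2^2 = 1 + t3 everywhere; t2 t3 = 3 t2 on Q8
   and t3 = 0 on every x^a y^b z^c with c not divisible by 3, where the sum of
   the cube roots of unity zeta^(r 3^(k-1) c), r < 3, vanishes as well. *)

Require Import Defs.
From HB Require Import structures.
From mathcomp Require Import all_boot all_order all_algebra.
From mathcomp Require Import all_fingroup all_solvable all_field all_character.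
From mathcomp Require Import complex ring lra zify.
From mathcomp Require Import reals trigo.

Set Implicit Arguments.
Unset Strict Implicit.
Unset Printing Implicit Defensive.

Import Order.TTheory GRing.Theory Num.Theory.
Local Open Scope ring_scope.

(** * Characters in characteristic zero and multiplicities of irreducibles *)

Section Multiplicities.

Variables (F : closedFieldType) (gT : finGroupType) (G : {group gT}).
Hypothesis charF0 : [pchar F] =i pred0.

Lemma pchar0_pgroup : ([pchar F]^').-group%g G.
Proof. by apply: sub_in_pnat (pnat_pi (cardG_gt0 G)) => p _ _; rewrite inE /= charF0. Qed.

Lemma mx_semisimple n (rG : mx_representation F G n) : mxsemisimple rG 1%:M.
Proof.
have sG := DecSocleType rG.
rewrite -(reducible_Socle1 sG (mx_Maschke_pchar rG pchar0_pgroup)) /Socle.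
by apply: sumsmx_semisimple => W _; apply: component_mx_semisimple (socle_simple W).
Qed.

(** Allows a linear relation between characters to be evaluated at an idempotent of the group
    ring. *)
Lemma mxtrace_gring_op n (rG : mx_representation F G n) A :
  \tr (gring_op rG A) = \sum_i gring_row A 0 i * \tr (rG (enum_val i)).
Proof.
rewrite gring_opE /gring_mx /= mulmx_sum_row !linear_sum; apply: eq_bigr => i _.
by rewrite !linearZ /= rowK mxvecK.
Qed.

Variables (I : finType) (V : I -> representation F G).

Lemma mxtrace_dsum_grepr (a : I -> nat) x :
  \tr ((\big[dadd_grepr/grepr0]_j muln_grepr (V j) (a j) : representation F G) x)
  = \sum_j \tr (V j x) *+ a j.
Proof.
have dadd : {morph (fun W : representation F G => \tr (W x)) :
             U W / dadd_grepr U W >-> U + W} by move=> U W; apply: mxtrace_block.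
have zero : \tr ((grepr0 : representation F G) x) = 0 by rewrite mxtrace1.
rewrite (big_morph _ dadd zero); apply: eq_bigr => j _.
by rewrite /muln_grepr (big_morph _ dadd zero) sumr_const card_ord.
Qed.

Hypothesis irrV : irr_system V.

Lemma irr_degree_neq0 j : (rdegree (V j))%:R != 0 :> F.
Proof.
have [/(_ j) /mx_irrP[n_gt0 _] _ _] := irrV.
by move/pcharf0P: charF0 => ->; rewrite -lt0n.
Qed.

(** The Wedderburn idempotent of the class of [V j] acts as the identity on [V j] and as zero on
    every other [V i]. Evaluating the relation there leaves [c j] times the degree of [V j], which
    is nonzero in characteristic zero. *)
Lemma mxtrace_irr_free (c : I -> F) :
  {in G, forall x, \sum_j c j * \tr (V j x) = 0} -> forall j, c j = 0.
Proof.
move=> c0 j; have [irrVi injV _] := irrV.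
pose sG : irrType F G := DecSocleType (regular_repr F G).
have F'G := pchar0_pgroup.
pose e := Wedderburn_id (irr_comp sG (V j)).
have opV i : gring_op (V i) e = (i == j)%:R%:M.
  have [->|neq_ij] := eqVneq i j.
    have: gring_op (V j) e = 1%:M; last by [].
    rewrite -(gring_op1 (V j)) -(Wedderburn_sum_id_pchar sG F'G) linear_sum.
    rewrite (bigD1 (irr_comp sG (V j))) //= big1 ?addr0 // => k nk.
    exact: (irr_comp'_op0_pchar F'G (irrVi j) nk (Wedderburn_id_mem _)).
  rewrite (irr_comp'_op0_pchar F'G (irrVi i) _ (Wedderburn_id_mem _)) ?raddf0 //.
  apply: contra neq_ij => /eqP eq_comp; apply/eqP; apply: injV.
  apply: mx_rsim_trans (rsim_irr_comp_pchar sG F'G (irrVi i)) _.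
  by apply: mx_rsim_sym; rewrite -eq_comp; apply: rsim_irr_comp_pchar.
have: \sum_i c i * \tr (gring_op (V i) e) = 0.
  under eq_bigr do rewrite mxtrace_gring_op mulr_sumr.
  rewrite exchange_big big1 // => g _ /=.
  under eq_bigr do rewrite mulrCA.
  by rewrite -mulr_sumr c0 ?mulr0 ?enum_valP.
rewrite (bigD1 j) //= big1 => [|i /negbTE ne_ij]; last first.
  by rewrite opV ne_ij mxtrace_scalar mul0rn mulr0.
rewrite addr0 opV eqxx mxtrace_scalar => /eqP; rewrite mulf_eq0.
by rewrite (negbTE (irr_degree_neq0 j)) orbF => /eqP.
Qed.

Lemma mxtrace_irr_inj (a b : I -> nat) :
    {in G, forall x, \sum_j \tr (V j x) *+ a j = \sum_j \tr (V j x) *+ b j} ->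
  a =1 b.
Proof.
move=> eq_ab j; move/pcharf0P: (charF0) => charF.
have: (a j)%:R - (b j)%:R = 0 :> F.
  apply: (@mxtrace_irr_free (fun j => (a j)%:R - (b j)%:R)) => x Gx.
  under eq_bigr do rewrite mulrBl !mulr_natl.
  by rewrite big_split /= sumrN eq_ab ?subrr.
(* Truncated subtraction on [nat] agrees with subtraction in [F] only when [b j <= a j]. *)
move/eqP; rewrite subr_eq0; wlog le_ab : a b {eq_ab} / (b j <= a j)%N.
  move=> IH /eqP e; case/orP: (leq_total (b j) (a j)) => le; last symmetry;
    by apply: IH; rewrite ?e.
by rewrite -subr_eq0 -natrB // charF subn_eq0 => ge_ab; apply/eqP; rewrite eqn_leq ge_ab.
Qed.

(** Maschke's theorem gives a direct sum of simple submodules [U j]. Those of type [V i] add up to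
    the isotypic component [W i], and their number is the multiplicity. *)
Lemma mx_rsim_irr_decomp n (rG : mx_representation F G n) :
  exists m : I -> nat,
    mx_rsim rG (\big[dadd_grepr/grepr0]_j muln_grepr (V j) (m j)).
Proof.
have [_ _ complV] := irrV.
have [J U S simU defU dxU] := mx_semisimple rG.
have modU j : mxmodule rG (U j) by case: (simU j).
have /fin_all_exists[f simf] j : exists i, mx_rsim (submod_repr (modU j)) (V i).
  by apply: complV; apply/submod_mx_irr.
have [W WE] : exists W : I -> 'M_n, forall i, W i = (\sum_(j | f j == i) U j)%MS.
  by exists (fun i => (\sum_(j | f j == i) U j)%MS).
have modW i : mxmodule rG (W i) by rewrite WE; apply: sumsmx_module.
have defW : (\sum_i W i :=: 1%:M)%MS.
  apply: eqmx_trans defU; rewrite /S.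
  apply/eqmxP/andP; split; apply/sumsmx_subP => i _.
    by rewrite WE; apply/sumsmx_subP => j _; apply: (sumsmx_sup j).
  by apply: (sumsmx_sup (f i)) => //; rewrite WE; apply: (sumsmx_sup i).
have rankW i : \rank (W i) = (\sum_(j | f j == i) \rank (U j))%N.
  rewrite WE; apply/eqP; rewrite -mxdirectE; apply/mxdirect_sumsP => j fj.
  have /mxdirect_sumsP/(_ j isT) dxj := dxU.
  apply/eqP; rewrite -submx0 -[X in (_ <= X)%MS]dxj capmxS //.
  by apply/sumsmx_subP => l /andP[_ nlj]; apply: (sumsmx_sup l).
(* Directness is additivity of ranks, which regrouping transfers from the [U j] to the [W i]. *)
have dxW : mxdirect (\sum_i W i).
  rewrite mxdirectE /= defW -defU (mxdirectP dxU) /=.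
  by rewrite (partition_big f xpredT) //=; apply/eqP; apply: eq_bigr => i _; rewrite rankW.
exists (fun i => #|[pred j | f j == i]|).
apply: mx_rsim_trans (mx_rsim_sym (rsim_submod1 (mxmodule1 rG) _)) _ => //.
apply: (mx_rsim_dsum (modU := modW) _ defW dxW) => i.
pose U' (l : 'I_#|[pred j | f j == i]|) := U (enum_val l).
have defW' : (\sum_l U' l :=: W i)%MS.
  rewrite WE; apply/eqmxP/andP; split; apply/sumsmx_subP => l.
    by move=> _; apply: (sumsmx_sup (enum_val l)) => //; apply: (enum_valP l).
  move=> fl; have Dl : l \in [pred j | f j == i] by [].
  by apply: (sumsmx_sup (enum_rank_in Dl l)); rewrite // /U' enum_rankK_in.
apply: (mx_rsim_dsum (modU := fun l => modU (enum_val l)) _ defW') => [|l].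
  rewrite mxdirectE /= defW' rankW; apply/eqP.
  by rewrite -(@big_enum_val _ _ _ _ [pred j | f j == i] (fun j => \rank (U j))).
by have := simf (enum_val l); rewrite (eqP (enum_valP l)).
Qed.

(** Some decomposition exists, and independence of characters forces its multiplicities. This turns
    the isomorphisms that define the quiver into trace identities. *)
Lemma mx_rsim_irr_multP n (rG : mx_representation F G n) (a : I -> nat) :
  mx_rsim rG (\big[dadd_grepr/grepr0]_j muln_grepr (V j) (a j)) <->
  {in G, forall x, \tr (rG x) = \sum_j \tr (V j x) *+ a j}.
Proof.
split=> [sim x Gx | tr_rG]; first by rewrite (mxtrace_rsim sim) ?mxtrace_dsum_grepr.
have [m sim] := mx_rsim_irr_decomp rG.
have eq_ma : m =1 a.
  apply: mxtrace_irr_inj => x Gx.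
  by rewrite -tr_rG // (mxtrace_rsim sim) ?mxtrace_dsum_grepr.
by under eq_bigr => j do rewrite -eq_ma.
Qed.

End Multiplicities.

(** The squared degrees of all irreducible classes add up to [#|G|]; a class outside the list would
    push the sum beyond that. *)
Lemma irr_system_of_degrees (F : closedFieldType) (gT : finGroupType)
    (G : {group gT}) (I : finType) (V : I -> representation F G) :
    [pchar F] =i pred0 -> (forall i, mx_irreducible (V i)) ->
    (forall i j, mx_rsim (V i) (V j) -> i = j) ->
    (#|G| <= \sum_i rdegree (V i) ^ 2)%N ->
  irr_system V.
Proof.
move=> charF0 irrV injV leG; split=> // n rG irrG.
pose sG : irrType F G := DecSocleType (regular_repr F G).
have F'G := pchar0_pgroup G charF0.
pose c i := irr_comp sG (V i).
have simc i : mx_rsim (V i) (irr_repr (c i)) := rsim_irr_comp_pchar sG F'G (irrV i).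
have inj_c : injective c.
  move=> i j eq_c; apply: injV; apply: mx_rsim_trans (simc i) _.
  by rewrite eq_c; apply: mx_rsim_sym.
have sim := rsim_irr_comp_pchar sG F'G irrG; set k := irr_comp sG rG in sim.
have [/imsetP[i _ Dk]|notk] := boolP (k \in c @: I).
  by exists i; apply: mx_rsim_trans sim _; rewrite Dk; apply: mx_rsim_sym.
have := sum_irr_degree_pchar sG F'G (@group_closure_closed_field F gT G).
rewrite (bigID [in c @: I]) /= big_imset /=; last by move=> i j _ _; apply: inj_c.
have degc i : irr_degree (c i) = rdegree (V i) := esym (mxrank_rsim (simc i)).
under eq_bigr do rewrite degc.
rewrite [X in (_ + X)%N](bigD1 k) //= => eqG; move: leG.
rewrite -eqG -[leqRHS]addn0 leq_add2l leqNgt addn_gt0 expn_gt0.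
by rewrite irr_degree_gt0.
Qed.

(** * Primitive roots of unity from trigonometric functions *)

Section Zeta.

Variable R : realType.

Lemma zetaX n j :
  zeta R n ^+ j = Complex (cos (2 * pi / n%:R *+ j)) (sin (2 * pi / n%:R *+ j)).
Proof.
elim: j => [|j IHj]; first by rewrite expr0 mulr0n cos0 sin0.
by rewrite exprSr IHj (mulrSr _ j) cosD sinD /zeta; congr Complex; rewrite addrC.
Qed.

Lemma zeta_prim_root n : (0 < n)%N -> n.-primitive_root (zeta R n).
Proof.
move=> n_gt0; apply/andP; split=> //; apply/forallP => j.
have n0 : n%:R != 0 :> R by rewrite pnatr_eq0 -lt0n.
rewrite unity_rootE zetaX; apply/eqP; have [->|ne_jn] := eqVneq j.+1 n.
  rewrite -mulr_natr divfK // mulr_natl cos2pi sin2pi; exact: eqxx.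
apply/eqP => /(congr1 (@complex.Re R)) /=.
pose u := pi / n%:R *+ j.+1 : R.
have -> : 2 * pi / n%:R *+ j.+1 = u *+ 2.
  by rewrite -mulrA mulr_natl mulrnAC.
have u_gt0 : 0 < u by rewrite /u pmulrn_lgt0 // divr_gt0 ?pi_gt0 ?ltr0n.
have u_lt : u < pi.
  rewrite /u -mulr_natr mulrAC ltr_pdivrMr ?ltr0n // ltr_pM2l ?pi_gt0 //.
  by rewrite ltr_nat ltn_neqAle ne_jn ltn_ord.
have := @sin_gt0_pi R u; rewrite u_gt0 u_lt => /(_ isT).
(* The real part is [cos (2u) = 1 - 2 sin(u)^2], which is below 1 since [0 < u < pi]. *)
move=> /(exprn_gt0 2); rewrite cos_mulr2n cos2sin2; lra.
Qed.

End Zeta.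

(** * Normal forms under right multiplication by the generators *)

Section NormalForm.

Variables (T : Type) (fx fy fz : T -> T) (N : nat) (t0 : T).
Hypotheses (fx4 : forall t, iter 4 fx t = t) (fy2 : forall t, fy (fy t) = fx (fx t)).
Hypotheses (fyxy : forall t, fy (fx (fy t)) = fx t).
Hypotheses (fzx : forall t, fx (fz t) = fz (fy t)).
Hypotheses (fzy : forall t, fy (fz t) = fz (fy (fx t))).
Hypotheses (N_gt0 : (0 < N)%N) (fzN : forall t, iter N fz t = t).

(** The maps stand for right multiplication, so this is [t0 X^a Y^b Z^c], and [fzx] reads
    [Z X = Y Z]. Maps on a bare type cover both the group and the matrix ring. *)
Definition normal_form (p : 'I_4 * 'I_2 * 'I_N) : T :=
  iter p.2 fz (iter p.1.2 fy (iter p.1.1 fx t0)).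

Let Q t := exists a b, (b < 2)%N /\ t = iter b fy (iter a fx t0).

Let Qx t : Q t -> Q (fx t).
Proof.
case=> a [b [lt_b ->]]; case: b lt_b => [|[|//]] _ /=; first by exists a.+1, 0%N.
(* [Y X = Y (Y X Y) = Y^2 X Y = X^3 Y]. *)
by exists a.+3, 1%N; rewrite /= -[in LHS]fyxy fy2.
Qed.

Let Qy t : Q t -> Q (fy t).
Proof.
case=> a [b [lt_b ->]]; case: b lt_b => [|[|//]] _ /=; first by exists a, 1%N.
by exists a.+2, 0%N; rewrite /= fy2.
Qed.

(** By [Z X = Y Z] and [Z Y = X Y Z], a generator appended after [Z^c] moves to its left as a word
    in [X] and [Y]. For [Y] the induction hypothesis serves twice, once per letter of [X Y]. *)
Let Qz c t : Q t -> (exists2 t', Q t' & fx (iter c fz t) = iter c fz t')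
                 /\ (exists2 t', Q t' & fy (iter c fz t) = iter c fz t').
Proof.
elim: c t => [|c IHc] t Qt /=.
  by split; [exists (fx t); first exact: Qx | exists (fy t); first exact: Qy].
have [[tx Qtx Etx] [ty Qty Ety]] := IHc t Qt; split.
  by exists ty; rewrite // fzx Ety.
have [_ [t' Qt' Et']] := IHc tx Qtx.
by exists t'; rewrite // fzy Etx Et'.
Qed.

Let iter_mod n f a t : (0 < n)%N -> (forall t, iter n f t = t) ->
  iter (a %% n) f t = iter a f t :> T.
Proof.
move=> n_gt0 fn; rewrite [in RHS](divn_eq a n) addnC iterD; congr iter.
by elim: (a %/ n)%N => //= q IHq; rewrite mulSn iterD -IHq fn.
Qed.

Let normal_formI c t : Q t -> exists p, iter c fz t = normal_form p.
Proof.
case=> a [b [lt_b ->]].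
exists (Ordinal (ltn_pmod a (isT : 0 < 4)%N), Ordinal lt_b, Ordinal (ltn_pmod c N_gt0)).
by rewrite /normal_form /= !iter_mod.
Qed.

Let normal_formE p : exists2 t, Q t & normal_form p = iter p.2 fz t.
Proof. by eexists=> //; exists p.1.1, p.1.2; split=> //; apply: ltn_ord. Qed.

Lemma normal_form_base : exists p, t0 = normal_form p.
Proof. by apply: (@normal_formI 0 t0); exists 0%N, 0%N. Qed.

Lemma normal_form_step p :
  [/\ exists p', fx (normal_form p) = normal_form p',
      exists p', fy (normal_form p) = normal_form p'
    & exists p', fz (normal_form p) = normal_form p'].
Proof.
have [t Qt ->] := normal_formE p.
have [[tx Qtx Etx] [ty Qty Ety]] := Qz p.2 Qt.
split; first by rewrite Etx; apply: normal_formI.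
  by rewrite Ety; apply: normal_formI.
exact: (normal_formI p.2.+1).
Qed.

End NormalForm.

(** * Normal form and order bound in the group *)

Section GroupBound.

Variables (gT : finGroupType) (N : nat) (x y z : gT).
Hypotheses (x2 : (x ^+ 2 = (x * y) ^+ 2)%g) (y2 : ((x * y) ^+ 2 = y ^+ 2)%g).
Hypotheses (zx : (z * x * z^-1 = y)%g) (zy : (z * y * z^-1 = x * y)%g).
Hypotheses (N_gt0 : (0 < N)%N) (zN : (z ^+ N = 1)%g).

Lemma P'_yxy : (y * x * y = x)%g.
Proof. by apply: (mulgI x); rewrite -[RHS]/(x ^+ 2)%g x2 expgS expg1 !mulgA. Qed.

Lemma P'_y2 : (y ^+ 2 = x ^+ 2)%g.
Proof. by rewrite -y2 -x2. Qed.

(* [y] centralises [y ^+ 2 = x ^+ 2] and inverts [x]. *)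
Lemma P'_x4 : (x ^+ 4 = 1)%g.
Proof.
have xVy : (x ^ y^-1 = x^-1)%g.
  have yx : (y * x = x * y^-1)%g by rewrite -{2}P'_yxy mulgK.
  rewrite conjgE invgK mulgA yx -mulgA -invMg -[(y * y)%g]/(y ^+ 2)%g P'_y2 invMg.
  by rewrite mulgA mulgV mul1g.
have : (x ^+ 2 ^ y^-1 = x ^+ 2)%g by rewrite -P'_y2 conjgE invgK mulgK.
by rewrite conjXg xVy expgVn => x2V; rewrite (expgD x 2 2) -[X in (X * _)%g]x2V mulVg.
Qed.

Lemma P'_zx : (z * x = y * z)%g.
Proof. by rewrite -zx mulgKV. Qed.

Lemma P'_zy : (z * y = x * y * z)%g.
Proof. by rewrite -zy mulgKV. Qed.

(** The elements whose right multiplication maps the set [D] of normal forms into itself form a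
    subgroup [H] containing the generators. Applying them to [1], which lies in [D], gives the
    claim. *)
Lemma P'_normal_form g : g \in <<[set x; y; z]>>%g ->
  exists p : 'I_4 * 'I_2 * 'I_N, g = (x ^+ p.1.1 * y ^+ p.1.2 * z ^+ p.2)%g.
Proof.
pose nf := normal_form ( *%g^~ x) ( *%g^~ y) ( *%g^~ z) (N := N) 1%g.
pose D := [set nf p | p in setT].
have iterM n (u t : gT) : iter n ( *%g^~ u) t = (t * u ^+ n)%g.
  by elim: n => [|n IHn] /=; [rewrite mulg1 | rewrite IHn expgSr mulgA].
have step d : d \in D -> [/\ (d * x)%g \in D, (d * y)%g \in D & (d * z)%g \in D].
  case/imsetP => p _ ->.
  suff [[px ex] [py ey] [pz ez]] :
      [/\ exists p', (nf p * x)%g = nf p', exists p', (nf p * y)%g = nf p'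
        & exists p', (nf p * z)%g = nf p'].
    by rewrite ex ey ez; split; apply: imset_f.
  apply: normal_form_step => // u.
  - by rewrite iterM P'_x4 mulg1.
  - by rewrite -!mulgA; apply: (congr1 (mulg u) P'_y2).
  - by rewrite -!mulgA [(y * (x * y))%g]mulgA P'_yxy.
  - by rewrite -[in RHS]mulgA -P'_zx mulgA.
  - by rewrite -[in RHS](mulgA _ x) -[in RHS]mulgA -P'_zy mulgA.
  by rewrite iterM zN mulg1.
pose H := [set h | [forall d in D, (d * h)%g \in D]].
have HP h : reflect (forall d, d \in D -> (d * h)%g \in D) (h \in H).
  by rewrite inE; apply: forall_inP.
have gH : group_set H.
  apply/group_setP; split=> [|h h' /HP Hh /HP Hh']; apply/HP => d Dd.
    by rewrite mulg1.
  by rewrite mulgA; apply: Hh'; apply: Hh.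
have D1 : 1%g \in D.
  suff [p ->] : exists p, 1%g = nf p by apply: imset_f.
  by apply: normal_form_base => // u; rewrite iterM (P'_x4, zN) mulg1.
have /subsetP sGH : <<[set x; y; z]>>%g \subset Group gH.
  rewrite gen_subG; apply/subsetP => h h_xyz; apply/HP => d /step[Dx Dy Dz].
  by move: h_xyz; rewrite !inE -orbA => /or3P[] /eqP ->.
move=> /sGH Hg; have : (1 * g)%g \in D by apply: (elimT (HP g)) D1.
by case/imsetP => p _; rewrite mul1g /nf /normal_form !iterM mul1g => ->; exists p.
Qed.

Lemma card_P'_le : (#|<<[set x; y; z]>>%g| <= 8 * N)%N.
Proof.
pose nf (p : 'I_4 * 'I_2 * 'I_N) := (x ^+ p.1.1 * y ^+ p.1.2 * z ^+ p.2)%g.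
have -> : (8 * N = #|[set: 'I_4 * 'I_2 * 'I_N]|)%N.
  by rewrite cardsT !card_prod !card_ord.
apply: leq_trans (leq_imset_card nf _); apply/subset_leq_card/subsetP => g Gg.
by have [p ->] := P'_normal_form Gg; apply: imset_f.
Qed.

End GroupBound.

(** * Von Dyck's theorem for P', into finite groups and then into rings *)

Definition P'_relations (gT : finGroupType) N (x y z : gT) :=
  [/\ (x ^+ 2 = (x * y) ^+ 2)%g, ((x * y) ^+ 2 = y ^+ 2)%g,
      (z * x * z^-1 = y)%g, (z * y * z^-1 = x * y)%g & (z ^+ N = 1)%g].

(* The subgroup of [gT * hT] generated by the pairs of corresponding generators
   satisfies the relations, so it is a homomorphic image of [P]; having [P] as its
   first projection, it is the graph of a morphism. *)
Lemma P'_von_Dyck k (gT hT : finGroupType) (P : {group gT}) (x y z : gT) (X Y Z : hT) :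
    is_P' k P x y z -> P'_relations (3 ^ k) X Y Z ->
  exists phi : gT -> hT,
    [/\ {in P &, {morph phi : g h / (g * h)%g}}, phi x = X, phi y = Y & phi z = Z].
Proof.
move=> [genP [x2 y2 zx zy zN] isoP] [X2 Y2 ZX ZY ZN].
pose x' := (x, X); pose y' := (y, Y); pose z' := (z, Z).
pose D := (<[x']> <*> <[y']> <*> <[z']>)%G.
have homD : (D \homg P)%g.
  have expg_pair (g : gT) (h : hT) n : ((g, h) ^+ n = (g ^+ n, h ^+ n))%g.
    by elim: n => // n IHn; rewrite !expgS IHn.
  (* [isoP] says that the homomorphic images of [P] are the groups generated by a triple satisfying
     the relations. *)
  rewrite isoP; apply/existsP; exists (x', y', z') => /=.
  have [e1 e2 e3 [e4 e5]] : [/\ (x' ^+ 2 = (x' * y') ^+ 2)%g,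
      ((x' * y') ^+ 2 = y' ^+ 2)%g, (z' * x' * z'^-1 = y')%g
    & (z' * y' * z'^-1 = x' * y')%g /\ (z' ^+ (3 ^ k) = 1)%g].
    split; [exact (f_equal2 pair x2 X2) | exact (f_equal2 pair y2 Y2)
      | exact (f_equal2 pair zx ZX) | split; first exact (f_equal2 pair zy ZY)].
    by rewrite expg_pair zN ZN.
  by rewrite e1 e2 e3 e4 e5.
have [xD yD zD] : [/\ x' \in D, y' \in D & z' \in D].
  rewrite -!cycle_subG; split; last exact: joing_subr.
    by apply: subset_trans (joing_subl _ _); apply: joing_subl.
  by apply: subset_trans (joing_subl _ _); apply: joing_subr.
pose f := restrm (subsetT D) (@fst gT hT).
have imf : (f @* D)%g = P.
  rewrite morphim_restrm setIid morphimY ?subsetT // morphimY ?subsetT //.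
  rewrite !morphim_cycle ?inE //= -genP /cycle (joing_idr _ [set z]).
  by rewrite (joing_idl [set x]) (joing_idr [set x]) (joing_idl ([set x] :|: [set y])).
(* Each of [D] and [P] is an image of the other, so their orders agree. *)
have injf : ('injm f)%g.
  rewrite -card_im_injm imf eqn_leq.
  rewrite -[in X in X && _]imf leq_morphim /=.
  by case/homgP: homD => h <-; apply: leq_morphim.
exists (fun g => (invm injf g).2); split.
- by move=> g h Pg Ph /=; rewrite morphM ?imf.
- by have /(congr1 snd) := invmE injf xD.
- by have /(congr1 snd) := invmE injf yD.
by have /(congr1 snd) := invmE injf zD.
Qed.

(* The generators permute the finite set of normal forms in [A] by right
   multiplication, which reduces the claim to [P'_von_Dyck]. *)
Lemma P'_ring_hom (A : nzRingType) (X Y Z : A) k (gT : finGroupType)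
    (P : {group gT}) (x y z : gT) :
    is_P' k P x y z ->
    X ^+ 4 = 1 -> Y ^+ 2 = X ^+ 2 -> Y * X * Y = X -> Z * X = Y * Z ->
    Z * Y = X * Y * Z -> Z ^+ (3 ^ k) = 1 ->
  exists phi : gT -> A,
    [/\ phi 1%g = 1, {in P &, forall g h, phi (g * h)%g = phi g * phi h},
        phi x = X, phi y = Y & phi z = Z].
Proof.
move=> hP X4 Y2 YXY ZX ZY ZN; have N_gt0 : (0 < 3 ^ k)%N by rewrite expn_gt0.
pose nf := normal_form ( *%R^~ X) ( *%R^~ Y) ( *%R^~ Z) (N := 3 ^ k) 1.
pose S := codom nf.
have iterM n (U t : A) : iter n ( *%R^~ U) t = t * U ^+ n.
  by elim: n => [|n IHn] /=; [rewrite mulr1 | rewrite IHn exprSr mulrA].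
have step s : s \in S -> [/\ s * X \in S, s * Y \in S & s * Z \in S].
  case/codomP => p ->.
  suff [[px ex] [py ey] [pz ez]] : [/\ exists p', nf p * X = nf p',
      exists p', nf p * Y = nf p' & exists p', nf p * Z = nf p'].
    by rewrite ex ey ez; split; apply: codom_f.
  apply: normal_form_step => // u.
  - by rewrite iterM X4 mulr1.
  - by rewrite -!mulrA -!expr2 Y2.
  - by rewrite -!mulrA [Y * (X * Y)]mulrA YXY.
  - by rewrite -[in RHS]mulrA -ZX mulrA.
  - by rewrite -[in RHS](mulrA _ X) -[in RHS]mulrA -ZY mulrA.
  by rewrite iterM ZN mulr1.
have S1 : 1 \in S.
  suff [p ->] : exists p, 1 = nf p by apply: codom_f.
  by apply: normal_form_base => // u; rewrite iterM (X4, ZN) mulr1.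
(* A right inverse [V] makes right multiplication by [U] injective on the finite set [S], hence a
   permutation. *)
have mulP U V : (forall s, s \in S -> s * U \in S) -> U * V = 1 ->
    exists u : {perm seq_sub S}, forall s, ssval (u s) = ssval s * U.
  move=> SU UV; pose r (s : seq_sub S) := SeqSub (SU _ (ssvalP s)).
  have inj_r : injective r.
    move=> s t /(congr1 (fun u => ssval u * V)); rewrite /= -!mulrA UV !mulr1.
    exact: val_inj.
  by exists (perm inj_r) => s; rewrite permE.
have XV : X * X ^+ 3 = 1 by rewrite -exprS.
have YV : Y * Y ^+ 3 = 1 by rewrite -exprS (exprM Y 2 2) Y2 -exprM.
have ZV : Z * Z ^+ (3 ^ k).-1 = 1 by rewrite -exprS prednK.
have [sx Esx] := mulP X _ (fun s Ss => let: And3 h _ _ := step s Ss in h) XV.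
have [sy Esy] := mulP Y _ (fun s Ss => let: And3 _ h _ := step s Ss in h) YV.
have [sz Esz] := mulP Z _ (fun s Ss => let: And3 _ _ h := step s Ss in h) ZV.
have eqp (s t : {perm seq_sub S}) : (forall u, ssval (s u) = ssval (t u)) -> s = t.
  by move=> eq_st; apply/permP => u; apply: val_inj; apply: eq_st.
have szX n u : ssval ((sz ^+ n)%g u) = ssval u * Z ^+ n.
  by rewrite permX; elim: n => [|n IHn] /=; [rewrite mulr1 | rewrite Esz IHn exprSr mulrA].
(* Permutations compose from left to right, so right multiplications keep the order of the
   factors. *)
have rel : P'_relations (3 ^ k) sx sy sz.
  split.
  - apply: eqp => u; rewrite !permM !(Esx, Esy) -!mulrA; congr (_ * _).
    by rewrite [Y * (X * Y)]mulrA YXY.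
  - apply: eqp => u; rewrite !permM !(Esx, Esy) -!mulrA; congr (_ * _).
    by rewrite [Y * (X * Y)]mulrA YXY -!expr2.
  - apply: (canLR (mulgK _)); apply: eqp => u; rewrite !permM !(Esx, Esy, Esz).
    by rewrite -!mulrA ZX.
  - apply: (canLR (mulgK _)); apply: eqp => u; rewrite !permM !(Esx, Esy, Esz).
    by rewrite -!mulrA ZY -!mulrA.
  by apply: eqp => u; rewrite szX ZN mulr1 perm1.
have [psi [psiM psix psiy psiz]] := P'_von_Dyck hP rel.
(* A right multiplication is determined by its value at [1], which defines [phi g]. *)
pose t1 := SeqSub S1; pose phi g := ssval (psi g t1).
have psi1 : psi 1%g = 1%g.
  by apply: (mulgI (psi 1%g)); rewrite -psiM ?group1 // !mulg1.
(* [H] collects the [g] whose permutation is right multiplication by [phi g]. On it [phi] is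
   multiplicative, and it is a group containing the generators. *)
pose H := [set g in P | [forall u, ssval (psi g u) == ssval u * phi g]].
have HP g : reflect (g \in P /\ forall u, ssval (psi g u) = ssval u * phi g) (g \in H).
  by rewrite inE; apply: (iffP andP) => -[Pg /'forall_eqP].
have phiM g h : g \in H -> h \in H -> phi (g * h)%g = phi g * phi h.
  by move=> /HP[Pg Hg] /HP[Ph Hh]; rewrite /phi psiM // permM Hh.
have phi1 : phi 1%g = 1 by rewrite /phi psi1 perm1.
have gH : group_set H.
  apply/group_setP; split=> [|g h Hg Hh]; apply/HP.
    by split=> // u; rewrite phi1 psi1 perm1 mulr1.
  have [/HP[Pg Eg] /HP[Ph Eh]] := (Hg, Hh).
  by split=> [|u]; rewrite ?groupM // phiM // psiM // permM Eh Eg mulrA.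
have [phix phiy phiz] : [/\ phi x = X, phi y = Y & phi z = Z].
  by rewrite /phi psix psiy psiz Esx Esy Esz !mul1r.
have [genP _ _] := hP.
have /subsetP sPH : <<[set x; y; z]>>%g \subset Group gH.
  rewrite gen_subG; apply/subsetP => g g_xyz.
  apply/HP; split; first by rewrite -genP mem_gen.
  move=> u; move: g_xyz; rewrite !inE -orbA => /or3P[] /eqP ->.
  - by rewrite psix Esx phix.
  - by rewrite psiy Esy phiy.
  by rewrite psiz Esz phiz.
rewrite genP in sPH.
by exists phi; split=> // g h /sPH Hg /sPH Hh; apply: phiM.
Qed.

(** * Arithmetic of explicit matrices of size 2 and 3 *)

Section SmallMatrices.

Variable F : comNzRingType.
Implicit Types a b c d : F.

Definition mx2 a b c d : 'M[F]_2 := mx_of_rows 2 [:: [:: a; b]; [:: c; d]].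

Lemma mx2M a b c d a' b' c' d' :
  mx2 a b c d * mx2 a' b' c' d' =
  mx2 (a * a' + b * c') (a * b' + b * d') (c * a' + d * c') (c * b' + d * d').
Proof.
apply/matrixP => -[[|[|//]] ?] -[[|[|//]] ?];
  by rewrite !mxE !big_ord_recl big_ord0 !mxE /= addr0.
Qed.

Lemma mx2_1 : 1 = mx2 1 0 0 1.
Proof. by apply/matrixP => -[[|[|//]] ?] -[[|[|//]] ?]; rewrite !mxE. Qed.

Lemma mxtrace_mx2 a b c d : \tr (mx2 a b c d) = a + d.
Proof. by rewrite /mxtrace !big_ord_recl big_ord0 !mxE /= addr0. Qed.

Lemma mx2N a b c d : - mx2 a b c d = mx2 (- a) (- b) (- c) (- d).
Proof. by apply/matrixP => -[[|[|//]] ?] -[[|[|//]] ?]; rewrite !mxE. Qed.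

Definition mx3 r : 'M[F]_3 := mx_of_rows 3 r.
Definition rv3 a b c : 'rV[F]_3 := \row_j nth 0 [:: a; b; c] j.

Lemma rv3E (v : 'rV[F]_3) : v = rv3 (v 0 0) (v 0 1) (v 0 2).
Proof.
by apply/rowP => -[[|[|[|//]]] ?]; rewrite mxE /=; congr (v _ _); apply: val_inj.
Qed.

Lemma rv3_mulmx a b c a1 b1 c1 a2 b2 c2 a3 b3 c3 :
  rv3 a b c *m mx3 [:: [:: a1; b1; c1]; [:: a2; b2; c2]; [:: a3; b3; c3]] =
  rv3 (a * a1 + b * a2 + c * a3) (a * b1 + b * b2 + c * b3)
      (a * c1 + b * c2 + c * c3).
Proof.
apply/rowP => -[[|[|[|//]]] ?];
  by rewrite !mxE !big_ord_recl big_ord0 !mxE /= addr0 !addrA.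
Qed.

Lemma rv3D a b c a' b' c' : rv3 a b c + rv3 a' b' c' = rv3 (a + a') (b + b') (c + c').
Proof. by apply/rowP => -[[|[|[|//]]] ?]; rewrite !mxE. Qed.

Lemma rv3Z d a b c : d *: rv3 a b c = rv3 (d * a) (d * b) (d * c).
Proof. by apply/rowP => -[[|[|[|//]]] ?]; rewrite !mxE. Qed.

Lemma mx3M a1 b1 c1 a2 b2 c2 a3 b3 c3 a1' b1' c1' a2' b2' c2' a3' b3' c3' :
  mx3 [:: [:: a1; b1; c1]; [:: a2; b2; c2]; [:: a3; b3; c3]] *
  mx3 [:: [:: a1'; b1'; c1']; [:: a2'; b2'; c2']; [:: a3'; b3'; c3']] =
  mx3 [:: [:: a1 * a1' + b1 * a2' + c1 * a3'; a1 * b1' + b1 * b2' + c1 * b3';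
              a1 * c1' + b1 * c2' + c1 * c3'];
          [:: a2 * a1' + b2 * a2' + c2 * a3'; a2 * b1' + b2 * b2' + c2 * b3';
              a2 * c1' + b2 * c2' + c2 * c3'];
          [:: a3 * a1' + b3 * a2' + c3 * a3'; a3 * b1' + b3 * b2' + c3 * b3';
              a3 * c1' + b3 * c2' + c3 * c3']].
Proof.
apply/matrixP => -[[|[|[|//]]] ?] -[[|[|[|//]]] ?];
  by rewrite !mxE !big_ord_recl big_ord0 !mxE /= addr0 !addrA.
Qed.

Lemma mx3_1 : 1 = mx3 [:: [:: 1; 0; 0]; [:: 0; 1; 0]; [:: 0; 0; 1]].
Proof. by apply/matrixP => -[[|[|[|//]]] ?] -[[|[|[|//]]] ?]; rewrite !mxE. Qed.

Lemma mxtrace_mx3 a1 b1 c1 a2 b2 c2 a3 b3 c3 :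
  \tr (mx3 [:: [:: a1; b1; c1]; [:: a2; b2; c2]; [:: a3; b3; c3]]) = a1 + b2 + c3.
Proof. by rewrite /mxtrace !big_ord_recl big_ord0 !mxE /= addr0 addrA. Qed.

End SmallMatrices.

(** * Irreducibility in degrees 2 and 3 *)

Section Irreducibility.

Variables (F : fieldType) (gT : finGroupType) (G : {group gT}).
Hypothesis F2 : 2%:R != 0 :> F.

(* A common eigenvector of two anticommuting invertible matrices would be killed
   by one of them. *)
Lemma mx_irr_anticommuting (rG : mx_representation F G 2) x y :
  x \in G -> y \in G -> rG x *m rG y = - (rG y *m rG x) -> mx_irreducible rG.
Proof.
move=> Gx Gy anti; apply/mx_irrP; split=> // U modU nzU.
rewrite /row_full eqn_leq rank_leq_col ltnNge /=; apply/negP => rU1.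
pose v := nz_row U; have nzv : v != 0 by rewrite nz_row_eq0.
have vU : (v <= U)%MS := nz_row_sub U.
(* A nonzero [U] of rank below 2 is the line of [v], so [v] is a common eigenvector. *)
have Uv : (U <= v)%MS.
  by rewrite -(geq_leqif (mxrank_leqif_sup vU)) rank_rV nzv.
have eig g : g \in G -> exists a, v *m rG g = a *: v.
  move=> Gg; apply/sub_rVP; apply: submx_trans Uv.
  exact: submx_trans (submxMr _ vU) (mxmoduleP modU g Gg).
have [a Ea] := eig x Gx; have [b Eb] := eig y Gy.
have : v *m (rG x *m rG y) = v *m (- (rG y *m rG x)) by rewrite anti.
rewrite mulmxN !mulmxA Ea Eb -!scalemxAl Ea Eb !scalerA => /eqP.
rewrite -subr_eq0 opprK -scalerDl scaler_eq0 (negbTE nzv) orbF [b * a]mulrC.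
rewrite -mulr2n -mulr_natl !mulf_eq0 (negbTE F2) /= => /orP[]/eqP Z0.
  move: nzv; rewrite -[v](repr_mxK rG Gx) Ea Z0 scale0r mul0mx eqxx //.
by move: nzv; rewrite -[v](repr_mxK rG Gy) Eb Z0 scale0r mul0mx eqxx.
Qed.

(* The eigenlines of the images of [x], [y] and [x * y] for the eigenvalue [1]
   are spanned by (0, 1, 1), (1, 0, 1) and (1, 1, 0): a nonzero submodule contains
   one of them, hence all three because [z] permutes them. *)
Lemma mx_irr_varsigma (rG : mx_representation F G 3) x y z (e : F) :
    x \in G -> y \in G -> z \in G -> e != 0 ->
    rG x = mx3 [:: [:: -1; -1; -1]; [:: 0; 0; 1]; [:: 0; 1; 0]] ->
    rG y = mx3 [:: [:: 0; 0; 1]; [:: -1; -1; -1]; [:: 1; 0; 0]] ->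
    rG z = e *: mx3 [:: [:: -1; -1; -1]; [:: 0; 1; 0]; [:: 1; 0; 0]] ->
  mx_irreducible rG.
Proof.
move=> Gx Gy Gz nze rGx rGy rGz; apply/mx_irrP; split=> // U modU nzU.
have actU (u : 'rV_3) g : g \in G -> (u <= U)%MS -> (u *m rG g <= U)%MS.
  by move=> Gg uU; apply: submx_trans (submxMr _ uU) (mxmoduleP modU g Gg).
have scaleU (a : F) (u : 'rV_3) : a != 0 -> (a *: u <= U)%MS -> (u <= U)%MS.
  by move=> nza; rewrite (eqmx_scale _ nza).
pose inU (a b c : F) := (rv3 a b c <= U)%MS.
have z1 : inU 0 1 1 -> inU 1 1 0.
  have E : rv3 0 1 1 *m rG z = e *: rv3 1 1 0.
    by rewrite rGz -scalemxAr rv3_mulmx !rv3Z; congr rv3; ring.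
  by move/(actU _ _ Gz); rewrite E; apply: scaleU; rewrite ?oppr_eq0.
have z2 : inU 1 1 0 -> inU 1 0 1.
  have E : rv3 1 1 0 *m rG z = (- e) *: rv3 1 0 1.
    by rewrite rGz -scalemxAr rv3_mulmx !rv3Z; congr rv3; ring.
  by move/(actU _ _ Gz); rewrite E; apply: scaleU; rewrite ?oppr_eq0.
have z3 : inU 1 0 1 -> inU 0 1 1.
  have E : rv3 1 0 1 *m rG z = (- e) *: rv3 0 1 1.
    by rewrite rGz -scalemxAr rv3_mulmx !rv3Z; congr rv3; ring.
  by move/(actU _ _ Gz); rewrite E; apply: scaleU; rewrite ?oppr_eq0.
suff [f1 f2 f3] : [/\ inU 0 1 1, inU 1 0 1 & inU 1 1 0].
  (* Twice a unit vector is the sum of two of these vectors minus the third. *)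
  rewrite -sub1mx; apply/row_subP => i; apply: (scaleU 2%:R) => //.
  rewrite [row i _]rv3E !mxE rv3Z.
  case: i => [[|[|[|//]]] lti] /=.
  - have -> : rv3 (2%:R * 1) (2%:R * 0) (2%:R * 0) =
      rv3 1 0 1 + rv3 1 1 0 + -1 *: rv3 0 1 1 :> 'rV[F]_3.
      by rewrite rv3Z !rv3D; congr rv3; ring.
    by rewrite !addmx_sub ?scalemx_sub.
  - have -> : rv3 (2%:R * 0) (2%:R * 1) (2%:R * 0) =
      rv3 0 1 1 + rv3 1 1 0 + -1 *: rv3 1 0 1 :> 'rV[F]_3.
      by rewrite rv3Z !rv3D; congr rv3; ring.
    by rewrite !addmx_sub ?scalemx_sub.
  have -> : rv3 (2%:R * 0) (2%:R * 0) (2%:R * 1) =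
    rv3 0 1 1 + rv3 1 0 1 + -1 *: rv3 1 1 0 :> 'rV[F]_3.
    by rewrite rv3Z !rv3D; congr rv3; ring.
  by rewrite !addmx_sub ?scalemx_sub.
pose v := nz_row U; have nzv : v != 0 by rewrite nz_row_eq0.
have vU : (v <= U)%MS := nz_row_sub U.
set a := v 0 0; set b := v 0 1; set c := v 0 2.
have Dv : v = rv3 a b c := rv3E v.
(* [rG x] is an involution with simple eigenvalue 1, so [1 + rG x] maps [v] into that eigenline;
   likewise for [y] and [x * y]. *)
have f1 : ((b + c - a) *: rv3 0 1 1 <= U)%MS.
  have -> : (b + c - a) *: rv3 0 1 1 = v + v *m rG x.
    by rewrite rGx Dv rv3_mulmx rv3D rv3Z; congr rv3; ring.
  by rewrite addmx_sub ?actU.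
have f2 : ((a + c - b) *: rv3 1 0 1 <= U)%MS.
  have -> : (a + c - b) *: rv3 1 0 1 = v + v *m rG y.
    by rewrite rGy Dv rv3_mulmx rv3D rv3Z; congr rv3; ring.
  by rewrite addmx_sub ?actU.
have f3 : ((a + b - c) *: rv3 1 1 0 <= U)%MS.
  have -> : (a + b - c) *: rv3 1 1 0 = v + v *m rG x *m rG y.
    by rewrite rGx rGy Dv !rv3_mulmx rv3D rv3Z; congr rv3; ring.
  by rewrite addmx_sub ?actU.
(* A nonzero coefficient puts one of the vectors in [U]. If all three vanish, their pairwise sums
   [2c], [2b], [2a] do too, and [v = 0]. *)
have [E1|/scaleU/(_ f1) u1] := eqVneq (b + c - a) 0; last by split; auto.
have [E2|/scaleU/(_ f2) u2] := eqVneq (a + c - b) 0; last by split; auto.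
have [E3|/scaleU/(_ f3) u3] := eqVneq (a + b - c) 0; last by split; auto.
case/eqP: nzv; rewrite Dv.
have half (u : F) : 2%:R * u = 0 -> u = 0 by move/eqP; rewrite mulf_eq0 (negbTE F2) => /eqP.
have -> : a = 0 by apply: half; rewrite -[RHS](addr0 0) -{1}E2 -E3; ring.
have -> : b = 0 by apply: half; rewrite -[RHS](addr0 0) -{1}E1 -E3; ring.
have -> : c = 0 by apply: half; rewrite -[RHS](addr0 0) -{1}E1 -E2; ring.
by apply/rowP => -[[|[|[|//]]] ?]; rewrite !mxE.
Qed.

End Irreducibility.

(** * Representations of P' from matrices satisfying the relations *)

Section Representations.

Variables (F : fieldType) (gT : finGroupType) (P : {group gT}) (x y z : gT) (k : nat).
Hypotheses (k_gt0 : (0 < k)%N) (hP : is_P' k P x y z).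

Lemma P'_gens_mem : [/\ x \in P, y \in P & z \in P].
Proof. by have [<- _ _] := hP; split; apply: mem_gen; rewrite !inE eqxx ?orbT. Qed.

Lemma P'_card_le : (#|P| <= 8 * 3 ^ k)%N.
Proof. by have [<- [x2 y2 zx zy zN] _] := hP; apply: card_P'_le; rewrite ?expn_gt0. Qed.

Lemma P'_elements g : g \in P ->
  exists a b c : nat, [/\ (a < 4)%N, (b < 2)%N & g = (x ^+ a * y ^+ b * z ^+ c)%g].
Proof.
have [<- [x2 y2 zx zy zN] _] := hP => Gg.
have [|p ->] := P'_normal_form x2 y2 zx zy _ zN Gg; first by rewrite expn_gt0.
by exists p.1.1, p.1.2, p.2; split; first apply: ltn_ord; first apply: ltn_ord.
Qed.

(** [Z X = Y Z] and [Z Y = X Y Z] are linear in [Z], so they survive scaling [Z] by [c]. One triple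
    of matrices thus yields a whole family of twists. *)
Lemma P'_repr_exists n (X Y Z : 'M[F]_n.+1) (c : F) :
    X ^+ 4 = 1 -> Y ^+ 2 = X ^+ 2 -> Y * X * Y = X -> Z * X = Y * Z ->
    Z * Y = X * Y * Z -> Z ^+ 3 = 1 -> c ^+ (3 ^ k) = 1 ->
  exists rG : mx_representation F P n.+1, [/\ rG x = X, rG y = Y & rG z = c *: Z].
Proof.
move=> X4 Y2 YXY ZX ZY Z3 cN.
have [|||phi [phi1 phiM phix phiy phiz]] := P'_ring_hom (Z := c *: Z) hP X4 Y2 YXY.
- by rewrite -scalerAl ZX scalerAr.
- by rewrite -scalerAl ZY scalerAr.
- by rewrite exprZn cN scale1r -(prednK k_gt0) expnS exprM Z3 expr1n.
have repr_phi : mx_repr P phi by split=> // g h Pg Ph; rewrite phiM.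
by exists (MxRepresentation repr_phi).
Qed.

(** Once the scalar is split off, [c] matters only modulo 3, so finitely many matrix products give
    all character values. *)
Lemma P'_mxtrace n (rG : mx_representation F P n.+1) (Z : 'M[F]_n.+1) (e : F) a b c :
    Z ^+ 3 = 1 -> rG z = e *: Z ->
  \tr (rG (x ^+ a * y ^+ b * z ^+ c)%g) =
    e ^+ c * \tr (rG x ^+ a * rG y ^+ b * Z ^+ (c %% 3)).
Proof.
have [Px Py Pz] := P'_gens_mem; move=> Z3 rGz.
rewrite !repr_mxM ?groupM ?groupX // !repr_mxX // rGz exprZn expr_mod //.
by rewrite -scalemxAr linearZ.
Qed.

End Representations.

(** * Character identities for the untwisted representations *)

Section Tables.

Variables (F : comNzRingType) (w : F).
Hypothesis w2 : w ^+ 2 = - 1 - w.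

Let X2 : 'M[F]_2 := mx_of_rows 2 [:: [:: 0; w ^+ 2]; [:: - w; 0]].
Let Y2 : 'M[F]_2 := mx_of_rows 2 [:: [:: w ^+ 2; 1]; [:: w ^+ 2; - w ^+ 2]].
Let Z2 : 'M[F]_2 := mx_of_rows 2 [:: [:: 0; w]; [:: - w ^+ 2; -1]].
Let X3 : 'M[F]_3 := mx_of_rows 3 [:: [:: -1; -1; -1]; [:: 0; 0; 1]; [:: 0; 1; 0]].
Let Y3 : 'M[F]_3 := mx_of_rows 3 [:: [:: 0; 0; 1]; [:: -1; -1; -1]; [:: 1; 0; 0]].
Let Z3 : 'M[F]_3 := mx_of_rows 3 [:: [:: -1; -1; -1]; [:: 0; 1; 0]; [:: 1; 0; 0]].

Let X2E : X2 = mx2 0 (- 1 - w) (- w) 0. Proof. by rewrite /X2 w2. Qed.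
Let Y2E : Y2 = mx2 (- 1 - w) 1 (- 1 - w) (- (- 1 - w)). Proof. by rewrite /Y2 w2. Qed.
Let Z2E : Z2 = mx2 0 w (- (- 1 - w)) (-1). Proof. by rewrite /Z2 w2. Qed.

Lemma varrho_relations :
  [/\ X2 ^+ 4 = 1, Y2 ^+ 2 = X2 ^+ 2, Y2 * X2 * Y2 = X2
    & [/\ Z2 * X2 = Y2 * Z2, Z2 * Y2 = X2 * Y2 * Z2 & Z2 ^+ 3 = 1]].
Proof.
rewrite X2E Y2E Z2E; split; last split; rewrite ?exprS ?expr0 ?mx2_1 ?mx2M;
  congr mx2; ring: w2.
Qed.

Lemma varsigma_relations :
  [/\ X3 ^+ 4 = 1, Y3 ^+ 2 = X3 ^+ 2, Y3 * X3 * Y3 = X3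
    & [/\ Z3 * X3 = Y3 * Z3, Z3 * Y3 = X3 * Y3 * Z3 & Z3 ^+ 3 = 1]].
Proof.
rewrite /X3 /Y3 /Z3 -!/(mx3 _); split; last split;
  rewrite ?exprS ?expr0 ?mx3_1 ?mx3M;
  congr (mx3 [:: [:: _; _; _]; [:: _; _; _]; [:: _; _; _]]); ring.
Qed.

Lemma varrho_anticommute : X2 * Y2 = - (Y2 * X2).
Proof. by rewrite X2E Y2E !mx2M mx2N; congr mx2; ring: w2. Qed.

Definition tr_varrho a b c := \tr (X2 ^+ a * Y2 ^+ b * Z2 ^+ c).
Definition tr_varsigma a b c := \tr (X3 ^+ a * Y3 ^+ b * Z3 ^+ c).

Let X2sq : X2 ^+ 2 = -1.
Proof. by rewrite X2E expr2 mx2M mx2_1 mx2N; congr mx2; ring: w2. Qed.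

Let X3sq : X3 ^+ 2 = 1.
Proof.
rewrite /X3 -!/(mx3 _) expr2 mx3M mx3_1.
by congr (mx3 [:: [:: _; _; _]; [:: _; _; _]; [:: _; _; _]]); ring.
Qed.

Let tr_varrho_addn2 a b c : tr_varrho a.+2 b c = - tr_varrho a b c.
Proof. by rewrite /tr_varrho (exprD X2 2 a) X2sq !mulN1r !mulNr linearN. Qed.

Let tr_varsigma_addn2 a b c : tr_varsigma a.+2 b c = tr_varsigma a b c.
Proof. by rewrite /tr_varsigma (exprD X3 2 a) X3sq mul1r. Qed.

(** [varrho_0] has determinant 1 and [varsigma_0] has the character of its symmetric square: the
    tensor square splits into its exterior and symmetric parts. *)
Lemma tr_varrho_sq a b c : (a < 4)%N -> (b < 2)%N -> (c < 3)%N ->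
  tr_varrho a b c ^+ 2 = 1 + tr_varsigma a b c.
Proof.
(* [x^2] acts as [-1] in degree 2 and as [1] in degree 3, which changes neither side. *)
wlog lta : a / (a < 2)%N.
  by case: a => [|[|a]] IH lta; [exact: IH | exact: IH |];
    rewrite tr_varrho_addn2 tr_varsigma_addn2 sqrrN;
    exact: (IH a lta (@ltn_trans 2 a 4 lta isT)).
move=> _; rewrite /tr_varrho /tr_varsigma X2E Y2E Z2E /X3 /Y3 /Z3 -!/(mx3 _).
case: a b c lta => [|[|//]] [|[|//]] [|[|[|//]]] _ _ _;
  rewrite ?expr0 ?expr1 ?expr2 ?mul1r ?mulr1 ?mx3_1 ?mx2_1 ?mx3M ?mx2M
    mxtrace_mx3 mxtrace_mx2; ring: w2.
Qed.

(** On Q8 the character of degree 2 vanishes off the centre, and the centre acts trivially in degree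
    3, with trace 3. *)
Lemma tr_varrhoM a b : (a < 4)%N -> (b < 2)%N ->
  tr_varrho a b 0 * tr_varsigma a b 0 = tr_varrho a b 0 *+ 3.
Proof.
wlog lta : a / (a < 2)%N.
  by case: a => [|[|a]] IH lta ltb; [exact: IH | exact: IH |];
    rewrite tr_varrho_addn2 tr_varsigma_addn2 mulNr mulNrn;
    rewrite (IH a lta (@ltn_trans 2 a 4 lta isT)).
move=> _; rewrite /tr_varrho /tr_varsigma X2E Y2E /X3 /Y3 -!/(mx3 _).
case: a b lta => [|[|//]] [|[|//]] _ _;
  rewrite ?expr0 ?expr1 ?mul1r ?mulr1 ?mx3_1 ?mx2_1 ?mx3M ?mx2M
    mxtrace_mx3 mxtrace_mx2; ring: w2.
Qed.

(** [z] and [z^2] permute cyclically the three eigenlines of Q8, so no diagonal entry survives in a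
    basis adapted to them. *)
Lemma tr_varsigma0 a b c : (a < 4)%N -> (b < 2)%N -> (0 < c < 3)%N ->
  tr_varsigma a b c = 0.
Proof.
wlog lta : a / (a < 2)%N.
  by case: a => [|[|a]] IH lta ltb ltc; [exact: IH | exact: IH |];
    rewrite tr_varsigma_addn2 (IH a lta (@ltn_trans 2 a 4 lta isT)).
move=> _; rewrite /tr_varsigma /X3 /Y3 /Z3 -!/(mx3 _).
case: a b c lta => [|[|//]] [|[|//]] [|[|[|//]]] // _ _ _;
  rewrite ?expr0 ?expr1 ?expr2 ?mul1r ?mulr1 ?mx3M mxtrace_mx3; ring.
Qed.

Lemma tr_varrho1 : tr_varrho 0 0 1 = -1.
Proof. by rewrite /tr_varrho Z2E !expr0 expr1 !mul1r mxtrace_mx2; ring. Qed.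

Lemma tr_varsigma1 : tr_varsigma 0 0 0 = 3%:R.
Proof. by rewrite /tr_varsigma !expr0 !mul1r mxtrace1. Qed.

End Tables.

(** * Exponents and indices modulo n *)

Section Zp.

Variable n : nat.
Hypothesis n_gt1 : (1 < n)%N.

Lemma prim_expr_Zp_nat (F : nzRingType) (e : F) m :
  e ^+ n = 1 -> e ^+ (m%:R : 'Z_n) = e ^+ m.
Proof. by move=> en; rewrite val_Zp_nat // expr_mod. Qed.

Lemma Zp_nat_eq (m m' : nat) : (m%:R == m'%:R :> 'Z_n) = (m == m' %[mod n])%N.
Proof. by rewrite -val_eqE /= !val_Zp_nat. Qed.

Lemma card_Zp_type : #|'Z_n| = n.
Proof. by rewrite card_ord Zp_cast. Qed.

Lemma Zp_add1 (i : 'Z_n) : i + 1 = (i + 1)%N%:R.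
Proof. by rewrite natrD natr_Zp. Qed.

Lemma prim_root_Zp_inj (F : fieldType) (e : F) (i j : 'Z_n) :
  n.-primitive_root e -> e ^+ i = e ^+ j -> i = j.
Proof.
move=> prim_e /eqP; rewrite (eq_prim_root_expr prim_e) => /eqP eq_ij.
have lt_n (l : 'Z_n) : (l < n)%N by rewrite -[X in (_ < X)%N](Zp_cast n_gt1).
by apply/val_inj; rewrite !modn_small in eq_ij.
Qed.

End Zp.

(** * Completeness of the list of irreducibles, and the quiver *)

Section McKay.

Variables (R : realType) (k : nat) (gT : finGroupType) (P : {group gT}) (x y z : gT).
Hypotheses (k_ge2 : (2 <= k)%N) (hP : is_P' k P x y z).
Variables (alpha : 'Z_(3 ^ k) -> mx_representation R[i] P 1)
          (varrho : 'Z_(3 ^ k) -> mx_representation R[i] P 2)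
          (varsigma : 'Z_(3 ^ k.-1) -> mx_representation R[i] P 3).
Hypothesis alphaE : forall j,
  [/\ alpha j x = 1%:M, alpha j y = 1%:M & alpha j z = alphaz R k j].
Hypothesis varrhoE : forall j,
  [/\ varrho j x = varrhox R, varrho j y = varrhoy R & varrho j z = varrhoz R k j].
Hypothesis varsigmaE : forall s,
  [/\ varsigma s x = varsigmax R, varsigma s y = varsigmay R
    & varsigma s z = varsigmaz R k s].

Let C : closedFieldType := R[i].
Let e : C := zeta R (3 ^ k).
Let w : C := zeta R 3.
Let M := (3 ^ k.-1)%N.
Let V := vertex_repr alpha varrho varsigma.

Let charC : [pchar C] =i pred0. Proof. exact: pchar_num. Qed.
Let k_gt0 : (0 < k)%N. Proof. exact: ltnW. Qed.
Let N_eq : (3 ^ k = 3 * M)%N. Proof. by rewrite /M -expnS prednK. Qed.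
Let M_gt1 : (1 < M)%N. Proof. by rewrite /M -(expn0 3) ltn_exp2l //; lia. Qed.
Let N_gt1 : (1 < 3 ^ k)%N. Proof. by rewrite N_eq; lia. Qed.

Lemma zeta_expn_prim : (3 ^ k).-primitive_root e.
Proof. by apply: zeta_prim_root; rewrite expn_gt0. Qed.

Let eN : e ^+ (3 ^ k) = 1. Proof. exact: prim_expr_order zeta_expn_prim. Qed.

Lemma zeta3_sq : w ^+ 2 = - 1 - w.
Proof.
have prim3 : 3.-primitive_root w by apply: zeta_prim_root.
have w3 : w ^+ 3 = 1 := prim_expr_order prim3.
have w1 : w != 1.
  by rewrite -(expr0 w) -[X in X != _]expr1 (eq_prim_root_expr prim3).
have /eqP : (w - 1) * (w ^+ 2 + w + 1) = 0.
  have -> : (w - 1) * (w ^+ 2 + w + 1) = w ^+ 3 - 1 by ring.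
  by rewrite w3 subrr.
rewrite mulf_eq0 subr_eq0 (negbTE w1) /= => /eqP E.
by rewrite -[LHS](subr0) -E; ring.
Qed.

Local Notation t2 := (tr_varrho w).
Local Notation t3 := (tr_varsigma C).

Lemma mxtrace_alpha j a b c :
  \tr (alpha j (x ^+ a * y ^+ b * z ^+ c)%g) = (e ^+ j) ^+ c.
Proof.
have [ax ay az] := alphaE j.
rewrite (P'_mxtrace (n := 0) (Z := 1) (e := e ^+ j) hP) ?expr1n //.
  by rewrite ax ay !expr1n !mul1r mxtrace1 mulr1.
by rewrite az /alphaz -scalemx1.
Qed.

Lemma mxtrace_varrho j a b c :
  \tr (varrho j (x ^+ a * y ^+ b * z ^+ c)%g) = (e ^+ j) ^+ c * t2 a b (c %% 3).
Proof.
have [rx ry rz] := varrhoE j.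
have [_ _ _ [_ _ Z3]] := varrho_relations zeta3_sq.
by rewrite (P'_mxtrace (n := 1) hP _ _ _ Z3 rz) rx ry.
Qed.

Lemma mxtrace_varsigma s a b c :
  \tr (varsigma s (x ^+ a * y ^+ b * z ^+ c)%g) = (e ^+ s) ^+ c * t3 a b (c %% 3).
Proof.
have [rx ry rz] := varsigmaE s.
have [_ _ _ [_ _ Z3]] := varsigma_relations C.
by rewrite (P'_mxtrace (n := 2) hP _ _ _ Z3 rz) rx ry.
Qed.

Lemma vertex_repr_irreducible v : mx_irreducible (V v).
Proof.
have [Px Py Pz] := P'_gens_mem hP.
have C2 : 2%:R != 0 :> C by rewrite pnatr_eq0.
case: v => [[i|i]|s] /=.
- by apply/mx_abs_irrW; apply: linear_mx_abs_irr.
- have [rx ry rz] := varrhoE i.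
  apply: (mx_irr_anticommuting C2 Px Py); rewrite rx ry.
  exact: varrho_anticommute zeta3_sq.
have [rx ry rz] := varsigmaE s.
apply: (mx_irr_varsigma C2 Px Py Pz _ rx ry rz).
by rewrite expf_neq0 // -/e (prim_root_eq0 zeta_expn_prim) -lt0n expn_gt0.
Qed.

Lemma vertex_repr_inj v v' : mx_rsim (V v) (V v') -> v = v'.
Proof.
have [Px Py Pz] := P'_gens_mem hP.
have prim_e := zeta_expn_prim.
have trE (u u' : vertex k) a b c : mx_rsim (V u) (V u') ->
    \tr (V u (x ^+ a * y ^+ b * z ^+ c)%g) = \tr (V u' (x ^+ a * y ^+ b * z ^+ c)%g).
  by move/mxtrace_rsim; apply; rewrite !groupM ?groupX.
case: v v' => [[i|i]|s] [[j|j]|s'] sim //=; try by case: (mxrank_rsim sim).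
- have := trE _ _ 0 0 1 sim; rewrite !mxtrace_alpha !expr1.
  by move/(prim_root_Zp_inj N_gt1 prim_e) ->.
- have := trE _ _ 0 0 1 sim; rewrite !mxtrace_varrho !expr1 tr_varrho1 ?zeta3_sq //.
  by rewrite !mulrN1 => /oppr_inj/(prim_root_Zp_inj N_gt1 prim_e) ->.
(* The trace of [varsigma] at [z] is zero, so [z^3] is used: there it is [3 e^(3s)], and [e^3] has
   order [3^(k-1)]. *)
have := trE _ _ 0 0 3 sim; rewrite !mxtrace_varsigma tr_varsigma1.
have C3 : 3%:R != 0 :> C by rewrite pnatr_eq0.
move/(mulIf C3); rewrite -!exprM mulnC [(s' * 3)%N]mulnC !exprM.
have prim_e3 : M.-primitive_root (e ^+ 3).
  have MN : (M %| 3 ^ k)%N by rewrite N_eq dvdn_mull.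
  by have := dvdn_prim_root prim_e MN; rewrite [X in (X %/ _)%N]N_eq mulnK // ltnW.
by move/(prim_root_Zp_inj M_gt1 prim_e3) ->.
Qed.

Lemma vertex_repr_irr_system : irr_system V.
Proof.
apply: irr_system_of_degrees charC vertex_repr_irreducible vertex_repr_inj _.
apply: leq_trans (P'_card_le hP) _.
rewrite !big_sumType /= !sum_nat_const !card_Zp_type // -/M N_eq; lia.
Qed.

Lemma targets_uniq (v : vertex k) : uniq (targets v).
Proof.
case: v => [[i|i]|s] //=; rewrite !inE !andbT !negb_or.
have inj (m m' : nat) :
    (vvarrho m%:R == vvarrho m'%:R :> vertex k) = (m == m' %[mod 3 ^ k])%N.
  by rewrite -Zp_nat_eq.
have E m m' : (m + s + 1 == m' + s + 1 %[mod 3 ^ k])%N = (m == m' %[mod 3 ^ k])%N.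
  by rewrite -!addnA eqn_modDr.
(* With [s + 1] written as [0 + s + 1], it remains that [0], [M] and [2M] are distinct below
   [3M]. *)
rewrite -[(s + 1)%N]add0n addnA !inj !E !modn_small ?N_eq; lia.
Qed.

Lemma mxtrace_targets v : {in P, forall g,
  \tr (prod_repr (varrho 1) (V v) g) = \sum_(u <- targets v) \tr (V u g)}.
Proof.
move=> g /(P'_elements hP)[a [b [c [lta ltb ->]]]].
rewrite [LHS]mxtrace_prod.
have c3 : (c %% 3 < 3)%N by rewrite ltn_mod.
have w2 := zeta3_sq.
have eZ (m : nat) : e ^+ (m%:R : 'Z_(3 ^ k)) = e ^+ m by apply: prim_expr_Zp_nat.
have e1 : e ^+ (1%R : 'Z_(3 ^ k)) = e by rewrite -[RHS]expr1 -(eZ 1%N).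
have t2_sq := tr_varrho_sq w2 lta ltb c3.
have eM : (e ^+ 3) ^+ M = 1 by rewrite -exprM -N_eq.
have e3 m : (c %% 3 = 0)%N -> (e ^+ m) ^+ c = ((e ^+ 3) ^+ m) ^+ (c %/ 3).
  by move=> c0; rewrite {1}(divn_eq c 3) c0 addn0 -!exprM; congr (_ ^+ _); lia.
case: v => [[i|i]|s]; rewrite /= ?big_cons big_nil addr0 ?Zp_add1 // /V /=
  !mxtrace_varrho ?mxtrace_alpha ?mxtrace_varsigma !(eZ, e1).
- by rewrite mulrAC -exprMn -exprS addn1.
- rewrite mulrACA -exprMn -exprS -addn1 -expr2 t2_sq mulrDr mulr1; congr (_ + _).
  (* Reducing the index of [varsigma] modulo [M] is harmless: its trace vanishes unless 3 divides
     [c], and then [e^c] is a power of [e^3], whose [M]-th power is 1. *)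
  have [c0|c_neq0] := posnP (c %% 3)%N; last by rewrite tr_varsigma0 ?c_neq0 ?mulr0.
  by congr (_ * _); rewrite !e3 // (prim_expr_Zp_nat M_gt1).
(* The three targets carry the factors [E], [eta E] and [eta^2 E], where [eta] is the [c]-th power
   of a primitive cube root of unity. *)
set E := (e ^+ (s + 1)) ^+ c; pose eta := (e ^+ M) ^+ c.
have -> : (e ^+ (M + s + 1)) ^+ c = eta * E by rewrite -addnA exprD exprMn.
have -> : (e ^+ (2 * M + s + 1)) ^+ c = eta ^+ 2 * E.
  rewrite -addnA exprD exprMn; congr (_ * _); rewrite /eta -!exprM.
  by congr (_ ^+ _); rewrite -mulnA mulnC -mulnA.
rewrite mulrACA -exprMn -exprS -addn1 -/E.
have [c0|c_neq0] := posnP (c %% 3)%N.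
  have -> : eta = 1 by rewrite /eta e3 // eM expr1n.
  by rewrite c0 tr_varrhoM // expr1n !mul1r mulrnAr !mulrS mulr0n addr0.
(* Both sides vanish: the left with [t3], the right because [eta] is now a nontrivial cube root of
   unity. *)
rewrite tr_varsigma0 ?c_neq0 //.
have eta1 : eta != 1.
  rewrite /eta -exprM -(expr0 e) (eq_prim_root_expr zeta_expn_prim) N_eq mod0n.
  by rewrite mulnC -muln_modl muln_eq0 negb_or -!lt0n c_neq0 ltnW.
have /eqP : (eta - 1) * (eta ^+ 2 + eta + 1) = 0.
  have -> : (eta - 1) * (eta ^+ 2 + eta + 1) = eta ^+ 3 - 1 by ring.
  by rewrite /eta -!exprM mulnCA (mulnC M) -N_eq mulnC exprM eN expr1n subrr.
rewrite mulf_eq0 subr_eq0 (negbTE eta1) /= => /eqP sum_eta.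
have -> : E * t2 a b (c %% 3) + (eta * E * t2 a b (c %% 3) + eta ^+ 2 * E * t2 a b (c %% 3))
  = E * t2 a b (c %% 3) * (eta ^+ 2 + eta + 1) by ring.
by rewrite sum_eta !mulr0.
Qed.

Lemma mckay_quiver_targets (a : vertex k -> vertex k -> nat) :
  mckay_quiver V (varrho 1) a <-> forall v u, a v u = (u \in targets v).
Proof.
have irrV := vertex_repr_irr_system.
have sum_targets v g : \sum_(u <- targets v) \tr (V u g)
    = \sum_u \tr (V u g) *+ (u \in targets v).
  rewrite big_uniq ?targets_uniq // big_mkcond; apply: eq_bigr => u _.
  by rewrite mulrb.
have simP v := mx_rsim_irr_multP charC irrV (prod_repr (varrho 1) (V v)).
split=> [quiver v u | Ea v].
  apply: (mxtrace_irr_inj charC irrV (b := fun u => u \in targets v)) => g Pg.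
  by rewrite -sum_targets -mxtrace_targets // ((simP v (a v)).1 (quiver v)).
apply: (simP v (a v)).2 => g Pg; rewrite mxtrace_targets // sum_targets.
by under [RHS]eq_bigr do rewrite Ea.
Qed.

End McKay.

(** * Existence of the representations and assembly *)

Theorem mainTheorem4 (R : realType) (k : nat) (hk : (2 <= k)%N)
    (gT : finGroupType) (P : {group gT}) (x y z : gT)
    (hP : is_P' k P x y z) :
  exists (alpha : 'Z_(3 ^ k) -> mx_representation R[i] P 1)
         (varrho : 'Z_(3 ^ k) -> mx_representation R[i] P 2)
         (varsigma : 'Z_(3 ^ k.-1) -> mx_representation R[i] P 3),
    [/\ forall j, [/\ alpha j x = 1%:M, alpha j y = 1%:M
                    & alpha j z = alphaz R k j],
        forall j, [/\ varrho j x = varrhox R, varrho j y = varrhoy R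
                    & varrho j z = varrhoz R k j],
        forall s, [/\ varsigma s x = varsigmax R, varsigma s y = varsigmay R
                    & varsigma s z = varsigmaz R k s]
      & let V := vertex_repr alpha varrho varsigma in
        let rhoNat := varrho 1 in
        [/\ irr_system V,
            forall v : vertex k, uniq (targets v)
          & forall a : vertex k -> vertex k -> nat,
              mckay_quiver V rhoNat a <->
              forall v w, a v w = (w \in targets v)]].
Proof.
have k_gt0 := ltnW hk.
have eN j : (zeta R (3 ^ k) ^+ j) ^+ (3 ^ k) = 1.
  by rewrite exprAC (prim_expr_order (zeta_expn_prim R k)) expr1n.
have /fin_all_exists[alpha alphaE] (j : 'Z_(3 ^ k)) :
    exists rG : mx_representation R[i] P 1,
    [/\ rG x = 1%:M, rG y = 1%:M & rG z = alphaz R k j].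
  (* Here [0] encodes size 1, and [X = Y = Z = 1] leaves the scalar alone to carry the character. *)
  have [|||||||rG [rx ry rz]] := @P'_repr_exists R[i] gT P x y z k k_gt0 hP 0 1 1 1
    (zeta R (3 ^ k) ^+ j); rewrite ?expr1n ?mulr1 //.
  by exists rG; rewrite rx ry rz scalemx1.
have /fin_all_exists[varrho varrhoE] (j : 'Z_(3 ^ k)) :
    exists rG : mx_representation R[i] P 2,
    [/\ rG x = varrhox R, rG y = varrhoy R & rG z = varrhoz R k j].
  have [X4 Y2 YXY [ZX ZY Z3]] := varrho_relations (zeta3_sq R).
  have [rG E] := P'_repr_exists (n := 1) k_gt0 hP X4 Y2 YXY ZX ZY Z3 (eN j).
  by exists rG; apply: E.
have /fin_all_exists[varsigma varsigmaE] (s : 'Z_(3 ^ k.-1)) :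
    exists rG : mx_representation R[i] P 3,
    [/\ rG x = varsigmax R, rG y = varsigmay R & rG z = varsigmaz R k s].
  have [X4 Y2 YXY [ZX ZY Z3]] := varsigma_relations R[i].
  have [rG E] := P'_repr_exists (n := 2) k_gt0 hP X4 Y2 YXY ZX ZY Z3 (eN s).
  by exists rG; apply: E.
exists alpha, varrho, varsigma; split=> //; split.
- exact: (vertex_repr_irr_system hk hP alphaE varrhoE varsigmaE).
- exact: targets_uniq.
exact: (mckay_quiver_targets hk hP alphaE varrhoE varsigmaE).
Qed.
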